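(* Let $d,n\ge1$ and let $A_0,A_1,\dots,A_n\in\mathbb{C}^{d\times d}_{\mathrm{herm}}$. Consider the following two semidefinite programs. (P) minimize $c$ over $c\in\mathbb{R}$, $Z\in\mathbb{C}^{d\times d}_{\mathrm{herm}}$ subject to $$\begin{bmatrix} cI_d-A_0-Z & A_1 & A_2&\cdots & A_n\\ A_1 & Z & 0&\cdots & 0\\ A_2&0&Z&\cdots&0\\ \vdots&\vdots&\vdots&\ddots&\vdots\\ A_n&0&0&\cdots&Z\end{bmatrix}\succeq 0;$$ (D) maximize $$\left\langle \begin{bmatrix} A_0 & -A_1&\cdots&-A_n\\ -A_1&0&\cdots&0\\ \vdots&\vdots&\ddots&\vdots\\ -A_n&0&\cdots&0\end{bmatrix},\ \Gamma\right\rangle$$ over block matrices $\Gamma=[\Gamma^{[i,j]}]_{i,j=0}^n$ with blocks $\Gamma^{[i,j]}\in\mathbb{C}^{d\times d}$ satisfying $(\Gamma^{[i,j]})^*=\Gamma^{[j,i]}$ for all $0\le i,j\le n$, subject to $\Gamma\succeq 0$, $\Gamma^{[0,0]}=\sum_{i=1}^n\Gamma^{[i,i]}$, and $\mathrm{Tr}(\Gamma^{[0,0]})=1$. Then the values of (P) and (D) are both equal to $\Lambda_{\mathrm{sc}}(A_0,A_1,\dots,A_n)$. The two programs are Lagrangian duals of one another, and the minimum in (P) and the maximum in (D) are both always achieved.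
   Context: $\mathbb{C}^{d\times d}_{\mathrm{herm}}$ is the set of $d\times d$ complex Hermitian matrices; $\succeq$, $\succ$ denote the Loewner order; $\langle X,Y\rangle=\mathrm{Tr}(X^*Y)$. For a bounded self-adjoint operator, $\lambda_{\max}$ is the maximum of its spectrum. A free semicircular family $(s_i)_{i=1}^n$ consists of freely independent self-adjoint operators each with the standard semicircle law on $[-2,2]$; concretely $s_i=l_i+l_i^*$ with $l_i$ the creation operators on the full Fock space over $\mathbb{C}^n$ associated to the standard basis vectors. Define $$\Lambda_{\mathrm{sc}}(A_0,\dots,A_n)=\lambda_{\max}\Big(A_0\otimes 1+\sum_{i=1}^n A_i\otimes s_i\Big).$$ Known theorem of Lehner (1999), which may be taken as an equivalent definition: $\Lambda_{\mathrm{sc}}(A_0,\dots,A_n)=\inf_{Z\in\mathbb{C}^{d\times d}_{\mathrm{herm}},Z\succ 0}\lambda_{\max}\big(Z+A_0+\sum_{i=1}^n A_iZ^{-1}A_i\big)$. *)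

(* Defs.v *)
From HB Require Import structures.
From mathcomp Require Import all_boot all_order all_algebra.
From mathcomp Require Import all_classical all_reals all_analysis.
From mathcomp Require Import complex.

Set Implicit Arguments.
Unset Strict Implicit.
Unset Printing Implicit Defensive.

Import Order.TTheory GRing.Theory Num.Theory.

Local Open Scope classical_set_scope.
Local Open Scope ring_scope.
Local Open Scope complex_scope.
Local Open Scope sesquilinear_scope.

(* [0 <= z] in R[i] means that z is real and nonnegative. complex.Re is the real
   part R[i] -> R, unlike 'Re, which is R[i]-valued. *)

Definition psdmx (R : realType) (m : nat) (M : 'M[R[i]]_m) : Prop :=
  M \is hermsymmx /\ forall v : 'cV[R[i]]_m, 0 <= (v ^t* *m M *m v) 0 0.

Definition pdmx (R : realType) (m : nat) (M : 'M[R[i]]_m) : Prop :=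
  M \is hermsymmx /\
  forall v : 'cV[R[i]]_m, v != 0 -> 0 < (v ^t* *m M *m v) 0 0.

(* The set of real eigenvalues is nonempty and finite for Hermitian M and
   m >= 1, so that the supremum is a maximum. *)
Definition lambda_max (R : realType) (m : nat) (M : 'M[R[i]]_m) : R :=
  sup [set r : R | eigenvalue M r%:C].

Definition mxinner (R : realType) (m : nat) (X Y : 'M[R[i]]_m) : R[i] :=
  \tr (X ^t* *m Y).

(* Families A_0, ..., A_n are functions on 'I_n.+1, and a sum over i = 1..n is
   a sum over the i != ord0. *)

(* lambda_max (A_0 (x) 1 + sum_i A_i (x) s_i) for a free semicircular family
   (s_i), given by Lehner's formula (1999). The set is nonempty and bounded below
   by lambda_max A_0 for Hermitian A_i and d >= 1. *)
Definition Lambda_sc (R : realType) (d n : nat)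
    (A : 'I_n.+1 -> 'M[R[i]]_d) : R :=
  inf [set lambda_max
             (Z + A ord0 + \sum_(i < n.+1 | i != ord0) A i *m invmx Z *m A i)
      | Z in [set Z : 'M[R[i]]_d | pdmx Z]].

Definition blocks (R : realType) (d n : nat) : Type :=
  'I_n.+1 -> 'I_n.+1 -> 'M[R[i]]_d.

Definition assemble (R : realType) (d n : nat) (B : blocks R d n) :
    'M[R[i]]_(\sum_(i < n.+1) d) :=
  \mxblock_(i < n.+1, j < n.+1) B i j.

Definition primal_mx (R : realType) (d n : nat) (A : 'I_n.+1 -> 'M[R[i]]_d)
    (c : R) (Z : 'M[R[i]]_d) : 'M[R[i]]_(\sum_(i < n.+1) d) :=
  assemble (fun i j : 'I_n.+1 =>
    if i == ord0 then
      (if j == ord0 then (c%:C)%:M - A ord0 - Z else A j)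
    else if j == ord0 then A i
    else if i == j then Z
    else 0).

Definition primal_feasible (R : realType) (d n : nat)
    (A : 'I_n.+1 -> 'M[R[i]]_d) (c : R) (Z : 'M[R[i]]_d) : Prop :=
  Z \is hermsymmx /\ psdmx (primal_mx A c Z).

Definition primal_value (R : realType) (d n : nat)
    (A : 'I_n.+1 -> 'M[R[i]]_d) : \bar R :=
  ereal_inf [set c%:E | c in [set c : R | exists Z, primal_feasible A c Z]].

Definition dual_mx (R : realType) (d n : nat) (A : 'I_n.+1 -> 'M[R[i]]_d) :
    'M[R[i]]_(\sum_(i < n.+1) d) :=
  assemble (fun i j : 'I_n.+1 =>
    if i == ord0 then (if j == ord0 then A ord0 else - A j)
    else if j == ord0 then - A i
    else 0).

(* mxinner is real on Hermitian arguments, so complex.Re loses nothing here. *)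
Definition dual_obj (R : realType) (d n : nat) (A : 'I_n.+1 -> 'M[R[i]]_d)
    (G : blocks R d n) : R :=
  complex.Re (mxinner (dual_mx A) (assemble G)).

Definition psd_blocks (R : realType) (d n : nat) (G : blocks R d n) : Prop :=
  (forall i j, (G i j) ^t* = G j i) /\ psdmx (assemble G).

Definition dual_feasible (R : realType) (d n : nat) (G : blocks R d n) : Prop :=
  [/\ psd_blocks G,
      G ord0 ord0 = \sum_(i < n.+1 | i != ord0) G i i
    & \tr (G ord0 ord0) = 1].

Definition dual_value (R : realType) (d n : nat)
    (A : 'I_n.+1 -> 'M[R[i]]_d) : \bar R :=
  ereal_sup [set (dual_obj A G)%:E
            | G in [set G : blocks R d n | dual_feasible G]].

(* Lagrangian of (P): the constraint primal_mx A c Z >= 0 has multiplier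
   G >= 0. *)
Definition primal_lagrangian (R : realType) (d n : nat)
    (A : 'I_n.+1 -> 'M[R[i]]_d) (c : R) (Z : 'M[R[i]]_d) (G : blocks R d n) : R :=
  c - complex.Re (mxinner (primal_mx A c Z) (assemble G)).

(* Lagrangian of (D), over the cone G >= 0: the constraint tr G_00 = 1 has
   multiplier c, and G_00 = sum_(i >= 1) G_ii has Hermitian multiplier Z. *)
Definition dual_lagrangian (R : realType) (d n : nat)
    (A : 'I_n.+1 -> 'M[R[i]]_d) (G : blocks R d n) (c : R) (Z : 'M[R[i]]_d) : R :=
  dual_obj A G + c * (1 - complex.Re (\tr (G ord0 ord0)))
  + complex.Re (mxinner Z (G ord0 ord0 - \sum_(i < n.+1 | i != ord0) G i i)).

(* The Lagrangian dual of (P) is to maximize, over all multipliers G >= 0, the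
   infimum of the Lagrangian over the variables (c, Z). It is (D) when this
   infimum is the objective of (D) at the feasible G and -oo at the others. *)
Definition dual_is_lagrangian_dual_of_primal (R : realType) (d n : nat)
    (A : 'I_n.+1 -> 'M[R[i]]_d) : Prop :=
  forall G : blocks R d n, psd_blocks G ->
    ereal_inf [set (primal_lagrangian A cZ.1 cZ.2 G)%:E
              | cZ in [set cZ : R * 'M[R[i]]_d | cZ.2 \is hermsymmx]]
    = (if `[< dual_feasible G >] then (dual_obj A G)%:E else -oo%E).

Definition primal_is_lagrangian_dual_of_dual (R : realType) (d n : nat)
    (A : 'I_n.+1 -> 'M[R[i]]_d) : Prop :=
  forall (c : R) (Z : 'M[R[i]]_d), Z \is hermsymmx ->
    ereal_sup [set (dual_lagrangian A G c Z)%:E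
              | G in [set G : blocks R d n | psd_blocks G]]
    = (if `[< primal_feasible A c Z >] then c%:E else +oo%E).

Definition primal_minimizer (R : realType) (d n : nat)
    (A : 'I_n.+1 -> 'M[R[i]]_d) (c : R) (Z : 'M[R[i]]_d) : Prop :=
  primal_feasible A c Z /\
  forall (c' : R) (Z' : 'M[R[i]]_d), primal_feasible A c' Z' -> c <= c'.

Definition dual_maximizer (R : realType) (d n : nat)
    (A : 'I_n.+1 -> 'M[R[i]]_d) (G : blocks R d n) : Prop :=
  dual_feasible G /\
  forall G' : blocks R d n, dual_feasible G' -> dual_obj A G' <= dual_obj A G.

(* Main.v *)
Require Import Defs.
From HB Require Import structures.
From mathcomp Require Import all_boot all_order all_algebra.
From mathcomp Require Import all_classical all_reals all_analysis.
From mathcomp Require Import complex.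
From mathcomp Require Import ring lra.

(** Write [P(c, Z)] for the block matrix of (P), [D] for the block matrix in
    the objective of (D), and [<X, Y> = Re Tr (X^* Y)]. Everything rests on the
    identity ([rip_primal_mx])

      [<P(c, Z), G> = c Re Tr G_00 - <D, G> - <Z, G_00 - sum_(i >= 1) G_ii>],

    valid for every block matrix [G]. Both Lagrangians are equal to
    [c - <P(c, Z), G>], which is affine in [(c, Z)] and in [G] separately; an
    affine function is unbounded unless its linear part vanishes, and
    [<P, G> >= 0] for all positive semidefinite [G] exactly when the Hermitian
    matrix [P] is positive semidefinite. This gives the two duality claims, and
    weak duality.

    The value of (P) is [Lambda_sc]: for positive definite [Z] a Schur
    complement ([psd_primal_schur]) turns feasibility of [(c, Z)] into
    [lambda_max (Z + A_0 + sum_i A_i Z^-1 A_i) <= c], and an arbitrary feasible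
    [(c, Z)] is a limit of such pairs, because [(c + e, Z + e)] is feasible with
    [Z + e] positive definite ([feasible_shift]). The minimum is attained
    ([primal_attained]) because a feasible [Z] lies between [0] and [c - A_0],
    so that the sublevel sets are compact.

    Strong duality and attainment in (D) come together ([strong_duality]). Let
    [p] be a lower bound of the values of (P). Over the compact convex set of
    pairs [(W, t)] with [W] positive semidefinite, [t >= 0] and
    [Tr W + t = 1], minimize the squared norm of

      [(W_00 - sum_(i >= 1) W_ii, <D, W> - p Tr W_00 - t)].

    If the minimum is zero, then the minimizing [W], normalized to
    [Tr W_00 = 1], is feasible for (D) with value at least [p]. If it is
    positive, the minimizing vector defines a hyperplane separating the image
    from the origin, and its first component, rescaled, is a [Z] for which some
    [(p - e, Z)] with [e > 0] is feasible, contradicting the choice of [p]. The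
    pair [(0, 1)] in the compact set is what forces the hyperplane to be
    non-vertical. *)

Set Implicit Arguments.
Unset Strict Implicit.
Unset Printing Implicit Defensive.

Import Order.TTheory GRing.Theory Num.Theory.
Import numFieldNormedType.Exports.
Local Open Scope ring_scope.
Local Open Scope complex_scope.
Local Open Scope sesquilinear_scope.

(** * The real inner product on complex matrices *)

Local Notation Re := (@complex.Re _).
Local Notation Im := (@complex.Im _).

Section RealPairing.
Context {R : realType}.
Implicit Types (z w : R[i]) (a : R).

Lemma ReD z w : Re (z + w) = Re z + Re w.
Proof. by case: z w => [? ?] []. Qed.

Lemma ImD z w : Im (z + w) = Im z + Im w.
Proof. by case: z w => [? ?] []. Qed.

Lemma ReM z w : Re (z * w) = Re z * Re w - Im z * Im w.
Proof. by case: z w => [? ?] []. Qed.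

Lemma ImM z w : Im (z * w) = Re z * Im w + Im z * Re w.
Proof. by case: z w => [? ?] []. Qed.

Lemma Re_conj z : Re z^*%R = Re z. Proof. by case: z. Qed.

Lemma Im_conj z : Im z^*%R = - Im z. Proof. by case: z. Qed.

Lemma Re_sum (I : finType) (P : pred I) (F : I -> R[i]) :
  Re (\sum_(i | P i) F i) = \sum_(i | P i) Re (F i).
Proof. exact: (@big_morph _ _ (@complex.Re R) 0 +%R 0 +%R ReD erefl). Qed.

Lemma Im_sum (I : finType) (P : pred I) (F : I -> R[i]) :
  Im (\sum_(i | P i) F i) = \sum_(i | P i) Im (F i).
Proof. exact: (@big_morph _ _ (@complex.Im R) 0 +%R 0 +%R ImD erefl). Qed.

Lemma complex_eqP z w : Re z = Re w -> Im z = Im w -> z = w.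
Proof. by case: z w => [? ?] [? ?] /= -> ->. Qed.

Lemma adjmxK m n (M : 'M[R[i]]_(m, n)) : M^t*^t* = M.
Proof. by apply/matrixP => i j; rewrite !mxE conjCK. Qed.

Lemma adjmxM m n p (M : 'M[R[i]]_(m, n)) (N : 'M[R[i]]_(n, p)) :
  (M *m N)^t* = N^t* *m M^t*.
Proof. by rewrite trmx_mul map_mxM. Qed.

Lemma adjmxD m n (M N : 'M[R[i]]_(m, n)) : (M + N)^t* = M^t* + N^t*.
Proof. by rewrite linearD /= map_mxD. Qed.

Lemma adjmxN m n (M : 'M[R[i]]_(m, n)) : (- M)^t* = - M^t*.
Proof. by rewrite linearN /= map_mxN. Qed.

Lemma adjmxZ m n a (M : 'M[R[i]]_(m, n)) : (a%:C *: M)^t* = a%:C *: M^t*.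
Proof.
apply/matrixP => i j; rewrite !mxE rmorphM /=; congr (_ * _).
exact: conjc_real.
Qed.

Lemma adjmx_sum m n (I : finType) (P : pred I) (F : I -> 'M[R[i]]_(m, n)) :
  (\sum_(i | P i) F i)^t* = \sum_(i | P i) (F i)^t*.
Proof.
apply: (big_morph (fun M : 'M[R[i]]_(m, n) => M^t*) (@adjmxD m n)).
by apply/matrixP => i j; rewrite !mxE rmorph0.
Qed.

Lemma adjmx_scalar m a : (a%:C%:M : 'M[R[i]]_m)^t* = a%:C%:M.
Proof.
apply/matrixP => i j; rewrite !mxE eq_sym rmorphMn /=; congr (_ *+ _).
exact: conjc_real.
Qed.

Lemma hermP m (M : 'M[R[i]]_m) : M \is hermsymmx <-> M^t* = M.
Proof.
split=> [/is_hermitianmxP|] H; last apply/is_hermitianmxP.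
  by move: H; rewrite expr0 scale1r => <-.
by rewrite expr0 scale1r H.
Qed.

(** The real part makes the trace pairing a symmetric real bilinear form on all
    matrices, positive definite, and equal to the complex pairing on Hermitian
    ones; real scalars act on matrices as [a%:C]. *)
Definition rip m (X Y : 'M[R[i]]_m) : R := Re (mxinner X Y).

Section Rip.
Variable m : nat.
Implicit Types X Y Z : 'M[R[i]]_m.

Lemma ripE X Y : rip X Y =
  \sum_i \sum_j (Re (X i j) * Re (Y i j) + Im (X i j) * Im (Y i j)).
Proof.
rewrite /rip /mxinner /mxtrace exchange_big /= Re_sum; apply: eq_bigr => i _.
rewrite mxE Re_sum; apply: eq_bigr => j _.
by rewrite !mxE ReM Re_conj Im_conj mulNr opprK.
Qed.

Lemma ripC X Y : rip X Y = rip Y X.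
Proof.
rewrite !ripE; apply: eq_bigr => i _; apply: eq_bigr => j _.
by rewrite mulrC [X in _ + X]mulrC.
Qed.

Lemma ripDr X Y Z : rip X (Y + Z) = rip X Y + rip X Z.
Proof. by rewrite /rip /mxinner mulmxDr mxtraceD ReD. Qed.

Lemma ripZr a X Y : rip X (a%:C *: Y) = a * rip X Y.
Proof. by rewrite /rip /mxinner -scalemxAr mxtraceZ ReM /= mul0r subr0. Qed.

Lemma ripDl X Y Z : rip (X + Y) Z = rip X Z + rip Y Z.
Proof. by rewrite ripC ripDr !(ripC Z). Qed.

Lemma ripZl a X Y : rip (a%:C *: X) Y = a * rip X Y.
Proof. by rewrite ripC ripZr ripC. Qed.

Lemma rip0r X : rip X 0 = 0.
Proof. by rewrite /rip /mxinner mulmx0 mxtrace0. Qed.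

Lemma rip0l X : rip 0 X = 0. Proof. by rewrite ripC rip0r. Qed.

Lemma ripNr X Y : rip X (- Y) = - rip X Y.
Proof. by apply/eqP; rewrite -subr_eq0 opprK -ripDr addNr rip0r. Qed.

Lemma ripNl X Y : rip (- X) Y = - rip X Y.
Proof. by rewrite ripC ripNr ripC. Qed.

Lemma rip_sumr (I : finType) (P : pred I) X (F : I -> 'M[R[i]]_m) :
  rip X (\sum_(i | P i) F i) = \sum_(i | P i) rip X (F i).
Proof. exact: (big_morph _ (ripDr X) (rip0r X)). Qed.

Lemma rip_ge0 X : 0 <= rip X X.
Proof.
rewrite ripE; do 2!(apply: sumr_ge0 => ? _).
by rewrite -!expr2 addr_ge0 ?sqr_ge0.
Qed.

Lemma rip_eq0 X : rip X X = 0 -> X = 0.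
Proof.
have pos (i j : 'I_m) : 0 <= Re (X i j) * Re (X i j) + Im (X i j) * Im (X i j).
  by rewrite -!expr2 addr_ge0 ?sqr_ge0.
rewrite ripE => /eqP; rewrite psumr_eq0 => [|i _]; last exact: sumr_ge0.
move=> /allP H; apply/matrixP => i j; rewrite mxE.
move: (H i); rewrite mem_index_enum => /(_ isT) /=.
rewrite psumr_eq0 // => /allP /(_ j); rewrite mem_index_enum => /(_ isT) /=.
rewrite -!expr2 paddr_eq0 ?sqr_ge0 // !sqrf_eq0 => /andP[/eqP r0 /eqP i0].
exact: complex_eqP.
Qed.

Lemma rip_tr a X : rip a%:C%:M X = a * Re (\tr X).
Proof.
by rewrite /rip /mxinner adjmx_scalar mul_scalar_mx mxtraceZ ReM /= mul0r subr0.
Qed.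

(** Testing positivity of quadratic forms becomes pairing with rank one
    matrices, which are themselves positive semidefinite. *)
Lemma rip_rank1 X (v : 'cV[R[i]]_m) :
  rip (v *m v^t*) X = Re ((v^t* *m X *m v) 0 0).
Proof.
rewrite /rip /mxinner adjmxM adjmxK -mulmxA mxtrace_mulC.
by rewrite /mxtrace big_ord1.
Qed.

Lemma qf_herm_real X (v : 'cV[R[i]]_m) : X^t* = X ->
  Im ((v^t* *m X *m v) 0 0) = 0.
Proof.
move=> hX; have : (v^t* *m X *m v)^t* = v^t* *m X *m v.
  by rewrite !adjmxM adjmxK hX mulmxA.
move/matrixP/(_ 0 0); set q := (_ *m _ *m _).
by rewrite mxE [q^T _ _]mxE => /(congr1 Im); rewrite Im_conj => ?; lra.
Qed.

Lemma psdmxP X : psdmx X <->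
  X^t* = X /\ forall v : 'cV[R[i]]_m, 0 <= rip (v *m v^t*) X.
Proof.
split=> -[H p]; [have h := (hermP _).1 H | have h := (hermP _).2 H];
  split=> // v; have := p v.
  by rewrite rip_rank1 lecE => /andP[].
by rewrite rip_rank1 lecE qf_herm_real // eqxx.
Qed.

Lemma pdmxP X : pdmx X <->
  X^t* = X /\ forall v : 'cV[R[i]]_m, v != 0 -> 0 < rip (v *m v^t*) X.
Proof.
split=> -[H p]; [have h := (hermP _).1 H | have h := (hermP _).2 H];
  split=> // v v0; have := p v v0.
  by rewrite rip_rank1 ltcE => /andP[].
by rewrite rip_rank1 ltcE qf_herm_real // eqxx.
Qed.

Lemma sqnormE (v : 'cV[R[i]]_m) :
  rip (v *m v^t*) 1%:M = \sum_i (Re (v i 0) ^+ 2 + Im (v i 0) ^+ 2).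
Proof.
rewrite rip_rank1 mulmx1 mxE Re_sum; apply: eq_bigr => i _.
by rewrite !mxE ReM Re_conj Im_conj mulNr opprK !expr2.
Qed.

Lemma sqnorm_gt0 (v : 'cV[R[i]]_m) : v != 0 -> 0 < rip (v *m v^t*) 1%:M.
Proof.
move=> v0; rewrite sqnormE lt0r sumr_ge0 ?andbT; last first.
  by move=> i _; rewrite addr_ge0 ?sqr_ge0.
apply: contra v0; rewrite psumr_eq0 => [/allP H|i _]; last first.
  by rewrite addr_ge0 ?sqr_ge0.
apply/eqP/colP => i; rewrite !mxE.
move: (H i); rewrite mem_index_enum => /(_ isT) /=.
rewrite paddr_eq0 ?sqr_ge0 // !sqrf_eq0 => /andP[/eqP r0 /eqP i0].
exact: complex_eqP.
Qed.

End Rip.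
End RealPairing.

(** * Positive semidefinite matrices and the largest eigenvalue *)

Section Psd.
Context {R : realType}.

Section Fixed.
Variable m : nat.
Implicit Types X Y Z : 'M[R[i]]_m.

Lemma psd0 : psdmx (0 : 'M[R[i]]_m).
Proof. by apply/psdmxP; split=> [|v]; rewrite ?rip0r // linear0 map_mx0. Qed.

Lemma psdD X Y : psdmx X -> psdmx Y -> psdmx (X + Y).
Proof.
move=> /psdmxP[hX pX] /psdmxP[hY pY]; apply/psdmxP; split=> [|v].
  by rewrite adjmxD hX hY.
by rewrite ripDr addr_ge0.
Qed.

Lemma psdZ (a : R) X : 0 <= a -> psdmx X -> psdmx (a%:C *: X).
Proof.
move=> a0 /psdmxP[hX pX]; apply/psdmxP; split=> [|v].
  by rewrite adjmxZ hX.
by rewrite ripZr mulr_ge0.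
Qed.

Lemma psd_rank1 (v : 'cV[R[i]]_m) : psdmx (v *m v^t*).
Proof.
apply/psdmxP; split=> [|u]; first by rewrite adjmxM adjmxK.
rewrite rip_rank1 mulmxA -[_ *m v *m _ *m _]mulmxA mxE big_ord1.
have -> : (v^t* *m u) 0 0 = ((u^t* *m v) 0 0)^*%R.
  by rewrite -[u in LHS]adjmxK -adjmxM; rewrite !mxE.
by rewrite ReM Re_conj Im_conj mulrN opprK -!expr2 addr_ge0 ?sqr_ge0.
Qed.

Lemma pdmx_psdmx X : pdmx X -> psdmx X.
Proof.
move=> /pdmxP[hX pX]; apply/psdmxP; split=> // v.
have [->|/pX/ltW//] := eqVneq v 0; by rewrite mul0mx rip0l.
Qed.

Lemma psd_add_scalar (e : R) X : 0 < e -> psdmx X -> pdmx (X + e%:C%:M).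
Proof.
move=> e0 /psdmxP[hX pX]; apply/pdmxP; split=> [|v v0].
  by rewrite adjmxD adjmx_scalar hX.
rewrite ripDr ltr_wpDl // -scalemx1 ripZr mulr_gt0 //.
exact: sqnorm_gt0.
Qed.

Lemma pd_unitmx X : pdmx X -> X \in unitmx.
Proof.
move=> /pdmxP[hX pX]; rewrite -row_free_unit -kermx_eq0; apply: contraT.
case/rowV0Pn => u /sub_kermxP uX u0.
have := pX (u^t*); rewrite rip_rank1 adjmxK uX mul0mx mxE ltxx; apply.
by apply: contra u0 => /eqP H; rewrite -[u]adjmxK H linear0 map_mx0.
Qed.

Lemma herm_invmx X : X^t* = X -> (invmx X)^t* = invmx X.
Proof. by move=> hX; rewrite trmx_inv map_invmx hX. Qed.

(** The vectors [e_i + w e_j] with [w] a fourth root of unity bound the real and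
    imaginary parts of [X i j] by [(X i i + X j j) / 2]. This is what bounds the
    feasible sets. *)
Lemma psd_entry_bound X (i j : 'I_m) : psdmx X ->
  `|Re (X i j)| <= Re (\tr X) /\ `|Im (X i j)| <= Re (\tr X).
Proof.
move=> /psdmxP[hX pX].
have test (w : R[i]) (k l : 'I_m) :
    0 <= Re (X k k) + (Re w ^+ 2 + Im w ^+ 2) * Re (X l l)
         + 2 * (Re w * Re (X k l) - Im w * Im (X k l)).
  have := pX (delta_mx k 0 + w *: delta_mx l 0); rewrite rip_rank1.
  have -> : (delta_mx k 0 + w *: delta_mx l 0 : 'cV[R[i]]_m)^t* =
            delta_mx 0 k + w^*%R *: delta_mx 0 l.
    apply/rowP => s; rewrite !mxE rmorphD rmorphM /=.
    by rewrite !rmorph_nat !eqxx !andbT.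
  have Xlk : X l k = (X k l)^*%R by rewrite -{1}hX !mxE.
  rewrite !mulmxDl !mulmxDr -!scalemxAl -!scalemxAr -!rowE -!colE !mxE Xlk.
  rewrite !(ReD, ReM, ImM, Re_conj, Im_conj) => ?; lra.
have diag k : 0 <= Re (X k k) by have := test 0 k k; rewrite /= => ?; lra.
have le_tr k : Re (X k k) <= Re (\tr X).
  by rewrite /mxtrace Re_sum (bigD1 k) //= lerDl sumr_ge0.
have := le_tr i; have := le_tr j; have := diag i; have := diag j.
have := test 1 i j; have := test (-1) i j.
have := test 'i%C i j; have := test (- 'i%C) i j.
rewrite /= => ? ? ? ? ? ? ? ?.
by split; rewrite ler_norml; apply/andP; split; lra.
Qed.

Lemma psd_tr_ge0 X : psdmx X -> 0 <= Re (\tr X).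
Proof.
move=> /psdmxP[_ pX]; rewrite /mxtrace Re_sum; apply: sumr_ge0 => i _.
have := pX (delta_mx i 0); rewrite rip_rank1.
have -> : (delta_mx i 0 : 'cV[R[i]]_m)^t* = delta_mx 0 i.
  by apply/rowP => s; rewrite !mxE rmorph_nat !eqxx andbT.
by rewrite -rowE -colE !mxE.
Qed.

Lemma psd_tr0 X : psdmx X -> Re (\tr X) = 0 -> X = 0.
Proof.
move=> pX trX; apply/matrixP => i j; rewrite mxE.
have [] := psd_entry_bound i j pX; rewrite trX !normr_le0 => /eqP r0 /eqP i0.
exact: complex_eqP.
Qed.

(** The spectral theorem as a sum of rank one projections, the form in which
    pairings and quadratic forms can be computed term by term. *)
Lemma herm_spectral X : X^t* = X ->
  exists (l : 'I_m -> R) (u : 'I_m -> 'cV[R[i]]_m),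
    [/\ X = \sum_k (l k)%:C *: (u k *m (u k)^t*),
        1%:M = \sum_k u k *m (u k)^t*,
        forall k, X *m u k = (l k)%:C *: u k
      & forall k, (u k)^t* *m u k = 1%:M].
Proof.
move=> /hermP hX; have /mxOverP real := hermitian_spectral_diag_real hX.
have /orthomx_spectralP := hermitian_normalmx hX.
have PU := spectral_unitarymx X; rewrite invmx_unitary //.
move: real PU; set P := spectralmx X; set D := spectral_diag X.
clearbody P D => real PU XE.
have PPt : P *m P^t* = 1%:M by apply/unitarymxP.
have PtP : P^t* *m P = 1%:M by exact: mulmx1C.
pose u k := col k (P^t*).
have ut k : (u k)^t* = row k P by apply/rowP => s; rewrite !mxE conjCK.
have DE k : (Re (D 0 k))%:C = D 0 k by rewrite RRe_real // real.
have sumE (f : 'I_m -> R[i]) :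
    \sum_k f k *: (u k *m (u k)^t*) = P^t* *m diag_mx (\row_k f k) *m P.
  apply/matrixP => i j; rewrite summxE mul_mx_diag mxE; apply: eq_bigr => k _.
  by rewrite !mxE big_ord1 !mxE conjCK mulrCA mulrA.
exists (fun k => Re (D 0 k)), u; split.
- under eq_bigr do rewrite DE.
  rewrite sumE (_ : \row_k D 0 k = D) //.
  by apply/rowP => k; rewrite mxE.
- under eq_bigr do rewrite -[_ *m _]scale1r.
  rewrite sumE (_ : diag_mx _ = 1%:M) ?mulmx1 //.
  by rewrite -diag_const_mx; congr diag_mx; apply/rowP => k; rewrite !mxE.
- move=> k; rewrite DE {1}XE /u !colE mulmxA -(mulmxA _ P) PPt mulmx1.
  rewrite scalemxAr -mulmxA; congr (_ *m _).
  apply/colP => s; rewrite mul_diag_mx !mxE.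
  by case: eqP => [->|]; rewrite ?mulr0.
- move=> k; rewrite ut /u colE mulmxA -row_mul PPt.
  by apply/matrixP => a b; rewrite -colE !mxE !ord1 !eqxx.
Qed.

(** Self-duality of the positive semidefinite cone, half of it: in an eigenbasis
    of [Y] the pairing is a sum of nonnegative multiples of values of the
    quadratic form of [X]. *)
Lemma rip_psd_ge0 X Y : psdmx X -> psdmx Y -> 0 <= rip X Y.
Proof.
move=> /psdmxP[_ pX] pY; have /psdmxP[hY _] := pY.
have [l [u [YE _ Yu uu]]] := herm_spectral hY.
rewrite YE rip_sumr; apply: sumr_ge0 => k _; rewrite ripZr ripC mulr_ge0 //.
have /psdmxP[_ /(_ (u k))] := pY.
by rewrite rip_rank1 -mulmxA Yu -scalemxAr uu !mxE eqxx mulr1.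
Qed.

(** Eigenvectors are row vectors [v] here, so the quadratic form is tested at
    [v^*]. *)
Lemma eigenvalue_le (c r : R) X : psdmx (c%:C%:M - X) -> eigenvalue X r%:C ->
  r <= c.
Proof.
move=> /psdmxP[_ pX] /eigenvalueP[v vX v0].
have /sqnorm_gt0 : v^t* != 0.
  by apply: contra v0 => /eqP H; rewrite -[v]adjmxK H linear0 map_mx0.
have := pX (v^t*); rewrite !rip_rank1 adjmxK mulmxBr mulmxBl vX mul_mx_scalar.
rewrite -!scalemxAl mulmx1 -scalerBl -rmorphB mxE ReM /= mul0r subr0 => H n0.
by rewrite -subr_ge0 -(pmulr_lge0 _ n0).
Qed.

Lemma herm_eigen_ub X : X^t* = X -> exists l : 'I_m -> R,
  (forall k, eigenvalue X (l k)%:C) /\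
  (forall c : R, (forall k, l k <= c) -> psdmx (c%:C%:M - X)).
Proof.
move=> hX; have [l [u [XE idE Xu uu]]] := herm_spectral hX.
exists l; split=> [k|c lc].
  apply/eigenvalueP; exists ((u k)^t*).
    by rewrite -{1}hX -adjmxM Xu adjmxZ.
  apply: contraTneq (oner_neq0 R[i]) => u0.
  have := uu k; rewrite u0 mul0mx => /matrixP/(_ 0 0)/eqP.
  by rewrite !mxE eqxx eq_sym oner_eq0.
rewrite -scalemx1 idE {1}XE scaler_sumr -sumrB.
elim/big_ind: _ => [||k _]; [exact: psd0|exact: psdD|].
by rewrite -scalerBl -rmorphB; apply: psdZ; [rewrite subr_ge0|exact: psd_rank1].
Qed.

(** For Hermitian [X], [lambda_max X] is the least [c] with [X <= c] in the
    Loewner order. The dimension must be positive, as the supremum of the empty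
    set is [0]. *)
Lemma lambda_max_herm X : (0 < m)%N -> X^t* = X ->
  (forall c : R, psdmx (c%:C%:M - X) -> lambda_max X <= c) /\
  psdmx ((lambda_max X)%:C%:M - X).
Proof.
move=> m0 hX; have [l [el ub]] := herm_eigen_ub hX.
have ne : ([set r : R | eigenvalue X r%:C] !=set0)%classic.
  by exists (l (Ordinal m0)); exact: el.
split=> [c pc|]; first by apply: ge_sup => // r; apply: eigenvalue_le pc.
apply: (ub) => k; apply: ub_le_sup; last exact: el.
exists (\sum_k `|l k|) => r; apply: eigenvalue_le; apply: ub => j.
apply: le_trans (ler_norm _) _.
by rewrite (bigD1 j) //= lerDl sumr_ge0.
Qed.

End Fixed.
End Psd.

(** * Block matrices and the Schur complement *)

Section Blocks.
Context {R : realType} {d n : nat}.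
Implicit Types (B G : blocks R d n) (A : 'I_n.+1 -> 'M[R[i]]_d)
  (Z : 'M[R[i]]_d).

Definition blocks_of (W : 'M[R[i]]_(\sum_(i < n.+1) d)) : blocks R d n :=
  fun i j => submxblock W i j.

Lemma blocks_ofK W : assemble (blocks_of W) = W.
Proof. exact: submxblockK. Qed.

Lemma assembleK B i j : blocks_of (assemble B) i j = B i j.
Proof. exact: mxblockK. Qed.

Lemma adj_assemble B : (assemble B)^t* = assemble (fun i j => (B j i)^t*).
Proof. by apply/matrixP => i j; rewrite !mxE. Qed.

Lemma eq_assemble B G : (forall i j, B i j = G i j) -> assemble B = assemble G.
Proof. by move=> H; apply: eq_mxblock. Qed.

Lemma rip_assemble B G :
  rip (assemble B) (assemble G) = \sum_i \sum_j rip (B i j) (G i j).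
Proof.
rewrite /rip /mxinner adj_assemble mul_mxblock mxtrace_mxblock Re_sum.
rewrite exchange_big; apply: eq_bigr => i _.
by rewrite (raddf_sum (@mxtrace R[i] d)) Re_sum.
Qed.

Lemma psd_blocksP B : psd_blocks B <-> psdmx (assemble B).
Proof.
split=> [[]//|pB]; split=> // i j; have /psdmxP[hB _] := pB.
move/(congr1 (fun W => blocks_of W j i)): hB.
by rewrite adj_assemble !assembleK.
Qed.

Lemma psd_blocks_of W : psdmx W -> psd_blocks (blocks_of W).
Proof. by move=> pW; apply/psd_blocksP; rewrite blocks_ofK. Qed.

(** The arrowhead shape shared by the constraint matrix of (P) and the objective
    of (D). *)
Definition arrow (X : 'M[R[i]]_d) A Z : blocks R d n := fun i j =>
  if i == ord0 then (if j == ord0 then X else A j)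
  else if j == ord0 then A i else if i == j then Z else 0.

Lemma rip_arrow X A Z G : rip (assemble (arrow X A Z)) (assemble G) =
  rip X (G ord0 ord0) + \sum_(i < n.+1 | i != ord0)
    (rip (A i) (G ord0 i) + rip (A i) (G i ord0) + rip Z (G i i)).
Proof.
rewrite rip_assemble (bigD1 ord0) //= (bigD1 ord0) //= {1}/arrow eqxx -addrA.
congr (_ + _); rewrite -big_split; apply: eq_bigr => i i0 /=.
rewrite -addrA {1}/arrow eqxx (negPf i0); congr (_ + _).
rewrite (bigD1 ord0) //= {1}/arrow (negPf i0) eqxx; congr (_ + _).
rewrite (bigD1 i) //= /arrow (negPf i0) eqxx big1 ?addr0 // => j.
by move=> /andP[j0 /negPf ji]; rewrite (negPf j0) eq_sym ji rip0l.
Qed.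

Lemma primal_mxE A c Z :
  primal_mx A c Z = assemble (arrow (c%:C%:M - A ord0 - Z) A Z).
Proof. by []. Qed.

Lemma dual_mxE A : dual_mx A = assemble (arrow (A ord0) (fun i => - A i) 0).
Proof. by apply: eq_assemble => i j; rewrite /arrow if_same. Qed.

(** The linear constraint of (D) says that this vanishes. *)
Definition balance G : 'M[R[i]]_d :=
  G ord0 ord0 - \sum_(i < n.+1 | i != ord0) G i i.

Lemma dual_objE A G : dual_obj A G = rip (A ord0) (G ord0 ord0)
  - \sum_(i < n.+1 | i != ord0) (rip (A i) (G ord0 i) + rip (A i) (G i ord0)).
Proof.
rewrite /dual_obj -/(rip _ _) dual_mxE rip_arrow -sumrN; congr (_ + _).
by apply: eq_bigr => i _; rewrite !ripNl rip0l addr0 opprD.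
Qed.

(** The pairing of the two programs. It exhibits [Z] as the multiplier of the
    linear constraint of (D) and [c] as that of the normalization. *)
Lemma rip_primal_mx A c Z G : rip (primal_mx A c Z) (assemble G) =
  c * Re (\tr (G ord0 ord0)) - dual_obj A G - rip Z (balance G).
Proof.
rewrite primal_mxE rip_arrow dual_objE /balance !(ripDl, ripDr, ripNl, ripNr).
rewrite rip_tr rip_sumr big_split /=; ring.
Qed.

Lemma herm_primal A c Z : (forall i, (A i)^t* = A i) -> Z^t* = Z ->
  (primal_mx A c Z)^t* = primal_mx A c Z.
Proof.
move=> hA hZ; rewrite primal_mxE adj_assemble; apply: eq_assemble => i j.
rewrite /arrow; case: (eqVneq i ord0) => _; case: (eqVneq j ord0) => _ //=.
  by rewrite !(adjmxD, adjmxN) adjmx_scalar hA hZ.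
by rewrite eq_sym; case: ifP => // _; rewrite linear0 map_mx0.
Qed.

Lemma rip_outer m (M : 'M[R[i]]_m) (a b : 'cV[R[i]]_m) : M^t* = M ->
  rip M (a *m b^t*) = Re ((b^t* *m M *m a) 0 0).
Proof.
move=> hM; rewrite /rip /mxinner hM mulmxA mxtrace_mulC mulmxA.
by rewrite /mxtrace big_ord1.
Qed.

(** The matrix in Lehner's formula; [c - schur_mx A Z] is the Schur complement
    of the diagonal blocks [Z] in the constraint matrix of (P). *)
Definition schur_mx A Z : 'M[R[i]]_d :=
  Z + A ord0 + \sum_(i < n.+1 | i != ord0) A i *m invmx Z *m A i.

Lemma herm_schur A Z : (forall i, (A i)^t* = A i) -> Z^t* = Z ->
  (schur_mx A Z)^t* = schur_mx A Z.
Proof.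
move=> hA hZ; rewrite /schur_mx !adjmxD hA hZ adjmx_sum; congr (_ + _).
by apply: eq_bigr => i _; rewrite !adjmxM hA herm_invmx // mulmxA.
Qed.

Lemma mxcol_outer (w : 'I_n.+1 -> 'cV[R[i]]_d) :
  \mxcol_i w i *m (\mxcol_i w i)^t* = assemble (fun i j => w i *m (w j)^t*).
Proof.
have -> : (\mxcol_i w i)^t* = \mxrow_i (w i)^t*.
  by apply/matrixP => i j; rewrite !mxE.
exact: mul_mxcol_mxrow.
Qed.

Lemma complete_square A Z (M : 'M[R[i]]_d) (a b : 'cV[R[i]]_d) :
  M^t* = M -> Z^t* = Z -> Z \in unitmx ->
  let y := b + invmx Z *m M *m a in
  rip (y *m y^t*) Z = rip M (a *m b^t*) + rip M (b *m a^t*)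
    + rip Z (b *m b^t*) + rip (a *m a^t*) (M *m invmx Z *m M).
Proof.
move=> hM hZ uZ y; rewrite [rip Z _]ripC !rip_outer // !rip_rank1.
rewrite /y adjmxD !adjmxM hM herm_invmx // !(mulmxDl, mulmxDr, mulmxA).
rewrite !(mulmxK, mulmxKV) // !mxE !ReD; ring.
Qed.

(** Block Gaussian elimination at the level of quadratic forms: completing the
    square in each block [w_i] separately is possible because the blocks [Z]
    interact only through [w_0]. *)
Lemma primal_qf A c Z (w : 'I_n.+1 -> 'cV[R[i]]_d) :
  (forall i, (A i)^t* = A i) -> Z^t* = Z -> Z \in unitmx ->
  let y i := w i + invmx Z *m A i *m w ord0 in
  rip (\mxcol_i w i *m (\mxcol_i w i)^t*) (primal_mx A c Z) =
  rip (w ord0 *m (w ord0)^t*) (c%:C%:M - schur_mx A Z)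
  + \sum_(i < n.+1 | i != ord0) rip (y i *m (y i)^t*) Z.
Proof.
move=> hA hZ uZ y; rewrite mxcol_outer ripC primal_mxE rip_arrow.
under [in RHS]eq_bigr do rewrite complete_square //.
rewrite [in RHS]big_split /= -rip_sumr /schur_mx !(ripDr, ripNr, ripDl, ripNl).
rewrite ![rip _ (w ord0 *m (w ord0)^t*)]ripC; ring.
Qed.

(** Forwards, [w] is chosen to make all the squares in [primal_qf] vanish. *)
Lemma psd_primal_schur A c Z : (forall i, (A i)^t* = A i) -> pdmx Z ->
  psdmx (primal_mx A c Z) <-> psdmx (c%:C%:M - schur_mx A Z).
Proof.
move=> hA pZ; have uZ := pd_unitmx pZ; have /psdmxP[hZ psZ] := pdmx_psdmx pZ.
split=> /psdmxP[_ P]; apply/psdmxP; split.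
- by rewrite adjmxD adjmxN adjmx_scalar herm_schur.
- move=> v; pose w i := if i == ord0 then v else - (invmx Z *m A i *m v).
  have := P (\mxcol_i w i); rewrite primal_qf // big1 => [|i i0].
    by rewrite addr0 /w eqxx.
  by rewrite {1 3}/w (negPf i0) /w eqxx addNr mul0mx rip0l.
- exact: herm_primal.
move=> v; rewrite -[v](submxcolK (p_ := fun=> d)) primal_qf //.
by rewrite addr_ge0 // sumr_ge0.
Qed.

End Blocks.

(** * Minimization over compact sets of complex matrices *)

Section Compactness.
Context {R : realType} {m : nat}.
Local Open Scope classical_set_scope.

(** A complex matrix together with a real number is read off from a vector of
    real coordinates, so that the Heine-Borel theorem applies. [None] indexes
    the number, and [Some (i, j, b)] the real ([b = false]) or imaginary
    ([b = true]) part of the entry [i, j]. *)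
Definition coords : finType := option ('I_m * 'I_m * bool)%type.
Local Notation E := 'rV[R]_#|{: coords}|.
Local Notation pt := ('M[R[i]]_m * R)%type.

Definition decode (x : E) : pt :=
  (\matrix_(i, j) (x 0 (enum_rank (Some (i, j, false) : coords))
                   +i* x 0 (enum_rank (Some (i, j, true) : coords))),
   x 0 (enum_rank (None : coords))).

Definition encode (p : pt) : E :=
  \row_k match enum_val k : coords with
         | None => p.2
         | Some (i, j, b) => if b then Im (p.1 i j) else Re (p.1 i j)
         end.

Lemma encodeK : cancel encode decode.
Proof.
move=> [M t]; rewrite /decode /encode; congr (_, _); last first.
  by rewrite mxE enum_rankK.
by apply/matrixP => i j; rewrite !mxE !enum_rankK /=; case: (M i j).
Qed.

(** Continuity and closedness for the topology transported from the coordinate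
    space. *)
Definition rcont (f : pt -> R) := continuous (f \o decode).

Definition rclosed (S : set pt) := closed (decode @^-1` S).

Lemma rcont_Re i j : rcont (fun p => Re (p.1 i j)).
Proof.
rewrite /rcont (_ : _ \o _ =
    fun x : E => x 0 (enum_rank (Some (i, j, false) : coords))).
  exact: coord_continuous.
by apply/funext => x /=; rewrite mxE.
Qed.

Lemma rcont_Im i j : rcont (fun p => Im (p.1 i j)).
Proof.
rewrite /rcont (_ : _ \o _ =
    fun x : E => x 0 (enum_rank (Some (i, j, true) : coords))).
  exact: coord_continuous.
by apply/funext => x /=; rewrite mxE.
Qed.

Lemma rcont_snd : rcont snd.
Proof. exact: coord_continuous. Qed.

Lemma rcont_cst a : rcont (fun=> a).
Proof. by apply: (@cst_continuous E R a). Qed.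

Lemma rcontD f g : rcont f -> rcont g -> rcont (fun p => f p + g p).
Proof. by move=> cf cg x; exact: (cvgD (cf x) (cg x)). Qed.

Lemma rcontM f g : rcont f -> rcont g -> rcont (fun p => f p * g p).
Proof. by move=> cf cg x; exact: (cvgM (cf x) (cg x)). Qed.

Lemma rcontN f : rcont f -> rcont (fun p => - f p).
Proof. by move=> cf x; exact: (cvgN (cf x)). Qed.

Lemma rcont_sum (I : finType) (P : pred I) (f : I -> pt -> R) :
  (forall i, P i -> rcont (f i)) -> rcont (fun p => \sum_(i | P i) f i p).
Proof.
move=> cf; rewrite (_ : (fun p => _) = \sum_(i | P i) f i); last first.
  by apply/funext => p; rewrite fct_sumE.
elim/big_ind: _ => [|f1 f2|//]; [exact: rcont_cst|exact: rcontD].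
Qed.

Lemma rcont_rip (W : 'M[R[i]]_m) : rcont (fun p => rip W p.1).
Proof.
under [X in rcont X]funext do rewrite ripE.
do 2!(apply: rcont_sum => ? _).
by apply: rcontD; apply: rcontM;
  first [exact: rcont_cst|exact: rcont_Re|exact: rcont_Im].
Qed.

Lemma rclosed_ge0 f : rcont f -> rclosed [set p | 0 <= f p].
Proof.
move=> cf; apply: (@preimage_closed _ _ (f \o decode) [set y | 0 <= y]).
  by move=> ? _; exact: cf.
exact: closed_ge.
Qed.

Lemma rclosed_eq0 f : rcont f -> rclosed [set p | f p = 0].
Proof.
move=> cf; rewrite (_ : [set p | _] =
    [set p | 0 <= f p] `&` [set p | 0 <= - f p]).
  by apply: closedI; apply: rclosed_ge0 => //; exact: rcontN.
apply/seteqP; split=> p /= => [->|[? ?]]; first by rewrite oppr0 lexx.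
by lra.
Qed.

Lemma rclosedI S T : rclosed S -> rclosed T -> rclosed (S `&` T).
Proof. exact: closedI. Qed.

Lemma rclosed_forall (J : Type) (S : J -> set pt) :
  (forall j, rclosed (S j)) -> rclosed [set p | forall j, S j p].
Proof.
move=> cS; rewrite /rclosed (_ : _ @^-1` _ = \bigcap_j (decode @^-1` S j)).
  by apply: closed_bigI => j _; exact: cS.
by apply/seteqP; split=> x /= H j; [move=> _|]; exact: H.
Qed.

Lemma rclosed_herm : rclosed [set p : pt | p.1^t* = p.1].
Proof.
rewrite (_ : [set p : pt | p.1^t* = p.1] = [set p : pt | forall i, forall j,
   (Re (p.1 i j) + - Re (p.1 j i) = 0) /\ (Im (p.1 i j) + Im (p.1 j i) = 0)]).
  do 2!apply: rclosed_forall => ?; apply: rclosedI; apply: rclosed_eq0.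
    by apply: rcontD; [|apply: rcontN]; exact: rcont_Re.
  by apply: rcontD; exact: rcont_Im.
apply/seteqP; split=> -[M t] /= H.
  move=> i j; have -> : M j i = (M i j)^*%R by rewrite -{1}H !mxE.
  by rewrite Re_conj Im_conj !subrr.
apply/matrixP => i j; have [? ?] := H i j; rewrite !mxE.
by apply: complex_eqP; rewrite ?Re_conj ?Im_conj; lra.
Qed.

Lemma rclosed_psd : rclosed [set p : pt | psdmx p.1].
Proof.
rewrite (_ : [set p : pt | psdmx p.1] = [set p : pt | p.1^t* = p.1] `&`
   [set p : pt | forall v : 'cV[R[i]]_m, 0 <= rip (v *m v^t*) p.1]).
  apply: rclosedI; first exact: rclosed_herm.
  by apply: rclosed_forall => v; apply: rclosed_ge0; exact: rcont_rip.
by apply/seteqP; split=> p /= /psdmxP.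
Qed.

Lemma compact_min (S : set pt) (f : pt -> R) (b : R) :
  rclosed S -> rcont f -> S !=set0 ->
  (forall p, S p -> `|p.2| <= b /\
     forall i j, `|Re (p.1 i j)| <= b /\ `|Im (p.1 i j)| <= b) ->
  exists2 p, S p & forall q, S q -> f p <= f q.
Proof.
move=> cS cf [p0 Sp0] bS.
have cpt : compact (decode @^-1` S).
  apply: bounded_closed_compact => //.
  exists b; split; first by rewrite num_real.
  move=> x xb y Sy; apply: le_trans (ltW xb).
  rewrite [leLHS]/Num.norm /= mx_normrE.
  have b0 : 0 <= b by apply: le_trans (bS _ Sy).1.
  apply/bigmax_leP; split=> // -[i k] _ /=; rewrite ord1.
  have [y2 y1] := bS _ Sy.
  rewrite -(enum_valK k); case: (enum_val k) => [[[r s] []]|] //.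
  - by have := (y1 r s).2; rewrite mxE.
  - by have := (y1 r s).1; rewrite mxE.
have ne : decode @^-1` S !=set0 by exists (encode p0); rewrite /= encodeK.
have [|x xS H] := compact_EVT_min ne cpt (f := f \o decode).
  exact: continuous_subspaceT.
exists (decode x); first by rewrite inE in xS.
move=> q Sq; have := H (encode q); rewrite /= encodeK; apply.
by rewrite inE /= encodeK.
Qed.

End Compactness.

(** * Feasible points of (P) and its value *)

Section Programs.
Context {R : realType} {d n : nat}.
Variable A : 'I_n.+1 -> 'M[R[i]]_d.
Hypotheses (d_gt0 : (0 < d)%N) (n_gt0 : (0 < n)%N).
Hypothesis hA : forall i, (A i)^t* = A i.
Implicit Types (Z : 'M[R[i]]_d) (W : 'M[R[i]]_(\sum_(i < n.+1) d)).

(** Test vectors supported on a single block. *)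
Lemma psd_block W i : psdmx W -> psdmx (blocks_of W i i).
Proof.
move=> pW; have [hB _] := psd_blocks_of pW.
have /psdmxP[_ P] := pW; apply/psdmxP; split=> [|u]; first exact: hB.
have := P (\mxcol_j (if j == i then u else 0)).
rewrite mxcol_outer -{1}[W]blocks_ofK rip_assemble (bigD1 i) //= (bigD1 i) //=.
rewrite !eqxx !big1 ?addr0 //.
  by move=> j /negPf ->; apply: big1 => k _; rewrite mul0mx rip0l.
by move=> j /negPf ->; rewrite linear0 map_mx0 mulmx0 rip0l.
Qed.

Lemma Re_tr_blocks W : Re (\tr W) = \sum_i Re (\tr (blocks_of W i i)).
Proof. by rewrite -{1}[W]blocks_ofK mxtrace_mxblock Re_sum. Qed.

Lemma tr_balance (G : blocks R d n) : Re (\tr (balance G)) =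
  Re (\tr (G ord0 ord0)) - \sum_(i < n.+1 | i != ord0) Re (\tr (G i i)).
Proof.
rewrite /balance raddfB /= (raddf_sum (@mxtrace R[i] d)) -Re_sum.
by case: (\tr _) (\sum_(i | _) _) => [? ?] [].
Qed.

Lemma herm_tr_real m (M : 'M[R[i]]_m) : M^t* = M -> (Re (\tr M))%:C = \tr M.
Proof.
move=> hM; apply: complex_eqP => //=; symmetry.
suff : Im (\tr M) = - Im (\tr M) by move=> ?; lra.
rewrite -Im_conj; congr Im; rewrite -{1}hM /mxtrace rmorph_sum.
by apply: eq_bigr => i _; rewrite !mxE.
Qed.

Lemma primal_feasibleP c Z : primal_feasible A c Z <->
  Z^t* = Z /\ forall v : 'cV_(\sum_(i < n.+1) d),
    0 <= rip (primal_mx A c Z) (v *m v^t*).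
Proof.
split=> [[/hermP hZ /psdmxP[_ P]]|[hZ P]].
  by split=> // v; rewrite ripC.
split; first exact/hermP.
by apply/psdmxP; split=> [|v]; [exact: herm_primal|rewrite ripC].
Qed.

Lemma rip_primal c Z W : rip (primal_mx A c Z) W =
  c * Re (\tr (blocks_of W ord0 ord0)) - rip (dual_mx A) W
  - rip Z (balance (blocks_of W)).
Proof.
by rewrite -{1}[W]blocks_ofK rip_primal_mx /dual_obj -/(rip _ _) blocks_ofK.
Qed.

Lemma weak_duality c Z G :
  primal_feasible A c Z -> dual_feasible G -> dual_obj A G <= c.
Proof.
move=> [_ pP] [[_ pG] bal trG]; have := rip_psd_ge0 pP pG.
by rewrite rip_primal_mx trG /balance bal subrr rip0r /= mulr1 subr0 subr_ge0.
Qed.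

(** The diagonal blocks of the constraint matrix; that of [Z] exists because
    [n >= 1]. *)
Lemma feasible_psd c Z : primal_feasible A c Z ->
  psdmx Z /\ psdmx (c%:C%:M - A ord0 - Z).
Proof.
move=> [_ pP]; split.
  have := psd_block ord_max pP; rewrite primal_mxE assembleK /arrow eqxx.
  by rewrite -val_eqE /= eqn0Ngt n_gt0.
by have := psd_block ord0 pP; rewrite primal_mxE assembleK.
Qed.

Lemma feasible_tr c Z : primal_feasible A c Z ->
  0 <= Re (\tr Z) <= c * d%:R - Re (\tr (A ord0)).
Proof.
move=> /feasible_psd[/psd_tr_ge0-> /psd_tr_ge0] /=.
rewrite !raddfB /= mxtrace_scalar -rmorphMn /= mulr_natr => ?; lra.
Qed.

Lemma feasible_lbound c Z : primal_feasible A c Z ->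
  Re (\tr (A ord0)) / d%:R <= c.
Proof.
move=> /feasible_tr/andP[t0 t1]; rewrite ler_pdivrMr ?ltr0n //; lra.
Qed.

(** In the corner block [c - A_0 - Z] the two shifts cancel, while [e] is added
    to all the other diagonal blocks. *)
Lemma feasible_shift c Z e : 0 < e -> primal_feasible A c Z ->
  primal_feasible A (c + e) (Z + e%:C%:M) /\ pdmx (Z + e%:C%:M).
Proof.
move=> e0 F; split.
  2: by apply: psd_add_scalar => //; exact: (feasible_psd F).1.
have /primal_feasibleP[hZ P] := F; apply/primal_feasibleP; split=> [|v].
  by rewrite adjmxD adjmx_scalar hZ.
have := P v; rewrite !rip_primal ripDl rip_tr tr_balance.
have : 0 <= \sum_(i < n.+1 | i != ord0) Re (\tr (blocks_of (v *m v^t*) i i)).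
  by apply: sumr_ge0 => i _; apply/psd_tr_ge0/psd_block/psd_rank1.
by move=> /(mulr_ge0 (ltW e0)) ? ?; lra.
Qed.

Lemma lehner_feasible Z : pdmx Z ->
  primal_feasible A (lambda_max (schur_mx A Z)) Z.
Proof.
move=> pZ; have /pdmxP[hZ _] := pZ; split; first exact/hermP.
apply/psd_primal_schur => //.
by have [] := lambda_max_herm d_gt0 (herm_schur hA hZ).
Qed.

Lemma lehner_le c Z : pdmx Z -> primal_feasible A c Z ->
  lambda_max (schur_mx A Z) <= c.
Proof.
move=> pZ [_ /psd_primal_schur H]; have /pdmxP[hZ _] := pZ.
have [le _] := lambda_max_herm d_gt0 (herm_schur hA hZ).
by apply: le; exact: H.
Qed.

Lemma pdmx1 : pdmx (1%:M : 'M[R[i]]_d).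
Proof.
by have := psd_add_scalar ltr01 (@psd0 R d); rewrite add0r.
Qed.

Lemma Lambda_sc_le c Z : primal_feasible A c Z -> Lambda_sc A <= c.
Proof.
move=> F; apply/ler_addgt0Pr => e e0; have [F' pZ] := feasible_shift e0 F.
apply: le_trans (lehner_le pZ F'); apply: ge_inf; last by exists (Z + e%:C%:M).
exists (Re (\tr (A ord0)) / d%:R) => _ [V pV <-].
exact: feasible_lbound (lehner_feasible pV).
Qed.

Lemma le_Lambda_sc c : (forall c' Z, primal_feasible A c' Z -> c <= c') ->
  c <= Lambda_sc A.
Proof.
move=> H; apply: lb_le_inf => [|_ [V pV <-]].
  by exists (lambda_max (schur_mx A 1%:M)); exists 1%:M => //; exact: pdmx1.
exact: H (lehner_feasible pV).
Qed.

(** Minimization of [c] on the sublevel set of the value at [Z = 1]: traces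
    bound [c] from below and, given an upper bound on [c], also the entries of
    [Z]. *)
Lemma primal_attained : exists Z, primal_feasible A (Lambda_sc A) Z.
Proof.
pose c0 := lambda_max (schur_mx A 1%:M).
pose S := [set p : 'M[R[i]]_d * R |
  primal_feasible A p.2 p.1 /\ p.2 <= c0]%classic.
pose lb := Re (\tr (A ord0)) / d%:R.
have SE : S = ([set p : 'M[R[i]]_d * R | p.1^t* = p.1] `&`
  [set p | forall v : 'cV_(\sum_(i < n.+1) d),
    0 <= rip (primal_mx A p.2 p.1) (v *m v^t*)] `&`
  [set p | 0 <= c0 - p.2])%classic.
  apply/seteqP; split=> p /=; rewrite /S /= subr_ge0.
    by move=> [/primal_feasibleP].
  by move=> [H ->]; split=> //; apply/primal_feasibleP.
have cS : rclosed S.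
  rewrite SE; apply: rclosedI; first apply: rclosedI.
  - exact: rclosed_herm.
  - apply: rclosed_forall => v; apply: rclosed_ge0.
    under [X in rcont X]funext do rewrite rip_primal [rip _ (balance _)]ripC.
    apply: rcontD; last by apply: rcontN; exact: rcont_rip.
    apply: rcontD; last exact: rcont_cst.
    by apply: rcontM; [exact: rcont_snd|exact: rcont_cst].
  - apply: rclosed_ge0; apply: rcontD; first exact: rcont_cst.
    by apply: rcontN; exact: rcont_snd.
pose b := `|lb| + `|c0| + `|c0 * d%:R - Re (\tr (A ord0))|.
have [|p Sp|[Z c] [/= F cc0] min] := compact_min (b := b) cS rcont_snd.
- by exists (1%:M, c0); split=> //=; exact: lehner_feasible pdmx1.
- case: p Sp => Z c [/= F cc0].
  have lbc := feasible_lbound F; have /andP[t0 t1] := feasible_tr F.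
  have tb : Re (\tr Z) <= b.
    apply: le_trans t1 _; rewrite /b.
    have : c * d%:R <= c0 * d%:R by rewrite ler_wpM2r.
    have := ler_norm (c0 * d%:R - Re (\tr (A ord0))).
    by have := normr_ge0 lb; have := normr_ge0 c0; lra.
  split=> [|i j].
    rewrite /b ler_norml.
    have := normr_ge0 (c0 * d%:R - Re (\tr (A ord0))).
    have := ler_norm c0; have := ler_norm (- lb); rewrite normrN.
    have := normr_ge0 lb; have := normr_ge0 c0; rewrite -/lb in lbc.
    by move=> *; apply/andP; split; lra.
  have [e1 e2] := psd_entry_bound i j (feasible_psd F).1.
  by split; apply: le_trans tb.
exists Z; rewrite (_ : Lambda_sc A = c) //; apply/eqP.
rewrite eq_le (Lambda_sc_le F) /=; apply: le_Lambda_sc => c' Z' F'.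
have [c'c0|/ltW c0c'] := leP c' c0; first exact: (min (Z', c')).
exact: le_trans c0c'.
Qed.

End Programs.

(** * Strong duality *)

Section StrongDuality.
Context {R : realType} {d n : nat}.
Variable A : 'I_n.+1 -> 'M[R[i]]_d.
Hypothesis hA : forall i, (A i)^t* = A i.
Local Notation dim := (\sum_(i < n.+1) d)%N.
Implicit Types (W : 'M[R[i]]_dim).

Lemma balance_affine (s : R) (W V : 'M[R[i]]_dim) :
  balance (blocks_of (V + s%:C *: (W - V))) =
  balance (blocks_of V)
  + s%:C *: (balance (blocks_of W) - balance (blocks_of V)).
Proof.
have E i : blocks_of (V + s%:C *: (W - V)) i i =
    blocks_of V i i + s%:C *: (blocks_of W i i - blocks_of V i i).
  by apply/matrixP => a b; rewrite !mxE.
rewrite /balance E; under eq_bigr do rewrite E.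
rewrite big_split /= -scaler_sumr sumrB.
rewrite opprD addrACA -scalerBr; congr (_ + _ *: _).
by rewrite opprD addrACA -opprD.
Qed.

Lemma balanceZ (s : R) W :
  balance (blocks_of (s%:C *: W)) = s%:C *: balance (blocks_of W).
Proof.
have E i : blocks_of (s%:C *: W) i i = s%:C *: blocks_of W i i.
  by apply/matrixP => a b; rewrite !mxE.
by rewrite /balance E scalerBr scaler_sumr; under eq_bigr do rewrite E.
Qed.

Lemma rcont_block (k l : 'I_n.+1) (i j : 'I_d) :
  rcont (fun p : 'M[R[i]]_dim * R => Re (blocks_of p.1 k l i j)) /\
  rcont (fun p : 'M[R[i]]_dim * R => Im (blocks_of p.1 k l i j)).
Proof.
split.
  under [X in rcont X]funext do rewrite mxE; exact: rcont_Re.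
under [X in rcont X]funext do rewrite mxE; exact: rcont_Im.
Qed.

Lemma rcont_balance :
  rcont (fun p : 'M[R[i]]_dim * R =>
           rip (balance (blocks_of p.1)) (balance (blocks_of p.1))).
Proof.
under [X in rcont X]funext do rewrite ripE.
do 2!(apply: rcont_sum => ? _).
have cRe i j :
    rcont (fun p : 'M[R[i]]_dim * R => Re (balance (blocks_of p.1) i j)).
  rewrite (_ : (fun p => _) = fun p : 'M[R[i]]_dim * R =>
      Re (blocks_of p.1 ord0 ord0 i j)
      + - \sum_(k < n.+1 | k != ord0) Re (blocks_of p.1 k k i j)).
    apply: rcontD; last apply: rcontN; last apply: rcont_sum => k _.
      by have [] := rcont_block ord0 ord0 i j.
    by have [] := rcont_block k k i j.
  apply/funext => p; rewrite /balance mxE ReD; congr (_ + _).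
  by rewrite mxE summxE -Re_sum; case: (\sum_(i | _) _).
have cIm i j :
    rcont (fun p : 'M[R[i]]_dim * R => Im (balance (blocks_of p.1) i j)).
  rewrite (_ : (fun p => _) = fun p : 'M[R[i]]_dim * R =>
      Im (blocks_of p.1 ord0 ord0 i j)
      + - \sum_(k < n.+1 | k != ord0) Im (blocks_of p.1 k k i j)).
    apply: rcontD; last apply: rcontN; last apply: rcont_sum => k _.
      by have [] := rcont_block ord0 ord0 i j.
    by have [] := rcont_block k k i j.
  apply/funext => p; rewrite /balance mxE ImD; congr (_ + _).
  by rewrite mxE summxE -Im_sum; case: (\sum_(i | _) _).
by apply: rcontD; apply: rcontM.
Qed.

Definition trace00 W : R := Re (\tr (blocks_of W ord0 ord0)).

Lemma rcont_trace00 :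
  rcont (fun p : 'M[R[i]]_dim * R => trace00 p.1).
Proof.
under [X in rcont X]funext do rewrite /trace00 /mxtrace Re_sum.
by apply: rcont_sum => i _; have [] := rcont_block ord0 ord0 i i.
Qed.

Lemma rcont_tr : rcont (fun p : 'M[R[i]]_dim * R => Re (\tr p.1)).
Proof.
under [X in rcont X]funext do rewrite /mxtrace Re_sum.
by apply: rcont_sum => i _; exact: rcont_Re.
Qed.

(** The first order condition at the left end point of a segment: a negative [a]
    is refuted at [s = - a / (b - a)]. *)
Lemma first_order (a b : R) : 0 <= b ->
  (forall s, 0 <= s <= 1 -> 0 <= 2 * s * a + s ^+ 2 * b) -> 0 <= a.
Proof.
move=> b0 H; rewrite leNgt; apply/negP => a0.
have ba : 0 < b - a by lra.
have s01 : 0 < - a / (b - a) <= 1.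
  by rewrite divr_gt0 ?oppr_gt0 //= ler_pdivrMr // mul1r; lra.
have sE : - a / (b - a) * (b - a) = - a by rewrite divfK // gt_eqF.
set s := - a / (b - a) in s01 sE; have /andP[s0 s1] := s01.
have := H s; rewrite s1 (ltW s0) => /(_ isT).
have -> : 2 * s * a + s ^+ 2 * b = s * (2 * a + s * b) by ring.
have : s * a <= 0 by rewrite mulr_ge0_le0 // ltW.
by rewrite pmulr_rge0 //; move: sE; rewrite mulrBr; lra.
Qed.

Lemma sqdist_expand m (b D : 'M[R[i]]_m) (r e s : R) :
  rip (b + s%:C *: D) (b + s%:C *: D) + (r + s * e) * (r + s * e) =
  rip b b + r * r
  + (2 * s * (rip b D + r * e) + s ^+ 2 * (rip D D + e ^+ 2)).
Proof. rewrite !(ripDl, ripDr, ripZl, ripZr) (ripC D b); ring. Qed.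

Lemma trace00_bound W : psdmx W -> 0 <= trace00 W <= Re (\tr W).
Proof.
move=> pW; rewrite psd_tr_ge0 /=; last exact: psd_block.
rewrite Re_tr_blocks (bigD1 ord0) //= lerDl sumr_ge0 // => i _.
exact/psd_tr_ge0/psd_block.
Qed.

(** The dual constraints other than normalization are homogeneous. *)
Lemma dual_feasible_of W : psdmx W -> balance (blocks_of W) = 0 ->
  0 < trace00 W ->
  let G := blocks_of ((trace00 W)^-1%:C *: W) in
  dual_feasible G /\ dual_obj A G = rip (dual_mx A) W / trace00 W.
Proof.
move=> pW bal0 t0 G; split; last first.
  by rewrite /dual_obj -/(rip _ _) blocks_ofK ripZr mulrC.
have pG : psdmx ((trace00 W)^-1%:C *: W).
  by apply: psdZ; rewrite // invr_ge0 ltW.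
split; first exact: psd_blocks_of.
  by apply/eqP; rewrite -subr_eq0 -/(balance G) balanceZ bal0 scaler0.
have /psdmxP[h00 _] := psd_block ord0 pG.
rewrite -herm_tr_real //.
have -> : G ord0 ord0 = (trace00 W)^-1%:C *: blocks_of W ord0 ord0.
  by apply/matrixP => a b; rewrite !mxE.
by rewrite mxtraceZ ReM /= mul0r subr0 mulVf // gt_eqF.
Qed.

Lemma balance0_trace00 W : balance (blocks_of W) = 0 ->
  Re (\tr W) = 2 * trace00 W.
Proof.
move=> bal0; have := tr_balance (blocks_of W); rewrite bal0 raddf0 /=.
by move=> ?; rewrite Re_tr_blocks (bigD1 ord0) //= /trace00; lra.
Qed.

(** The minimizer [(W0, t0)] is the point of a compact convex set whose image
    [(b0, r0)] is closest to the origin; [opt] is the variational inequality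
    characterizing it. *)
Lemma strong_duality (p : R) :
  (forall c Z, primal_feasible A c Z -> p <= c) ->
  exists G, dual_feasible G /\ p <= dual_obj A G.
Proof.
move=> plb.
pose bal (q : 'M[R[i]]_dim * R) := balance (blocks_of q.1).
pose r (q : 'M[R[i]]_dim * R) := rip (dual_mx A) q.1 - p * trace00 q.1 - q.2.
pose f q := rip (bal q) (bal q) + r q * r q.
pose S := [set q : 'M[R[i]]_dim * R | [/\ psdmx q.1, 0 <= q.2 &
  Re (\tr q.1) + q.2 + - 1 = 0]]%classic.
have cS : rclosed S.
  rewrite (_ : S = [set q | psdmx q.1] `&` [set q | 0 <= q.2] `&`
     [set q | Re (\tr q.1) + q.2 + - 1 = 0])%classic; last first.
    by apply/seteqP; split=> q /=; [case|case=> -[]].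
  apply: rclosedI; first apply: rclosedI.
  - exact: rclosed_psd.
  - exact: rclosed_ge0 rcont_snd.
  - apply: rclosed_eq0; apply: rcontD; last exact: rcont_cst.
    by apply: rcontD; [exact: rcont_tr|exact: rcont_snd].
have cr : rcont r.
  apply: rcontD; last by apply: rcontN; exact: rcont_snd.
  apply: rcontD; first exact: rcont_rip.
  by apply: rcontN; apply: rcontM; [exact: rcont_cst|exact: rcont_trace00].
have cf : rcont f.
  by apply: rcontD; [exact: rcont_balance|exact: rcontM].
have S01 : S (0, 1) by split=> //=; [exact: psd0|rewrite mxtrace0 /=; lra].
have [|[W t] Sq|[W0 t0] S0 min] := compact_min (b := 1) cS cf.
- by exists (0, 1).
- have [/= pW t_ge0 tr1] := Sq; have trW0 := psd_tr_ge0 pW.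
  split=> /= [|i j]; first by rewrite ger0_norm //; lra.
  have [e1 e2] := psd_entry_bound i j pW.
  by split; [apply: le_trans e1 _|apply: le_trans e2 _]; lra.
have [/= pW0 t0_ge0 tr0] := S0.
set b0 := bal (W0, t0) in min; set r0 := r (W0, t0) in min.
have opt q : S q -> f (W0, t0) <= rip b0 (bal q) + r0 * r q.
  move=> Sq; case: q Sq => W t Sq; have [/= pW t_ge0 tr1] := Sq.
  set b1 := bal (W, t); set r1 := r (W, t).
  suff : 0 <= rip b0 (b1 - b0) + r0 * (r1 - r0).
    by rewrite ripDr ripNr /f -/b0 -/r0 => ?; lra.
  apply: (@first_order _ (rip (b1 - b0) (b1 - b0) + (r1 - r0) ^+ 2)).
    by rewrite addr_ge0 ?rip_ge0 ?sqr_ge0.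
  move=> s /andP[s0 s1].
  pose qs := (W0 + s%:C *: (W - W0), t0 + s * (t - t0)).
  have Sqs : S qs.
    split=> /=.
    - rewrite (_ : _ + _ = (1 - s)%:C *: W0 + s%:C *: W).
        by apply: psdD; apply: psdZ => //; rewrite subr_ge0.
      rewrite rmorphB /= scalerBl scale1r scalerBr.
      by rewrite [_ *: W - _]addrC addrA.
    - have := mulr_ge0 s0 t_ge0.
      by have := mulr_ge0 (y := t0) (_ : 0 <= 1 - s); lra.
    - rewrite mxtraceD mxtraceZ raddfB /= ReD ReM /= mul0r subr0.
      have -> : Re (\tr W - \tr W0) = Re (\tr W) - Re (\tr W0).
        by case: (\tr W) (\tr W0) => [? ?] [].
      have -> : t = 1 - Re (\tr W) by lra.
      have -> : t0 = 1 - Re (\tr W0) by lra.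
      by ring.
  have := min qs Sqs; rewrite {2}/f.
  have -> : bal qs = b0 + s%:C *: (b1 - b0) by exact: balance_affine.
  have -> : r qs = r0 + s * (r1 - r0).
    rewrite /r0 /r1 /r /= ripDr ripZr ripDr ripNr.
    have -> : trace00 (W0 + s%:C *: (W - W0)) =
       trace00 W0 + s * (trace00 W - trace00 W0).
      rewrite /trace00.
      have -> : blocks_of (W0 + s%:C *: (W - W0)) ord0 ord0 =
        blocks_of W0 ord0 ord0
        + s%:C *: (blocks_of W ord0 ord0 - blocks_of W0 ord0 ord0).
        by apply/matrixP => a b; rewrite !mxE.
      rewrite mxtraceD mxtraceZ ReD ReM /= mul0r subr0 raddfB /=.
      by case: (\tr (blocks_of W _ _)) (\tr (blocks_of W0 _ _)) => [? ?] [].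
    by ring.
  by rewrite sqdist_expand /f -/b0 -/r0 lerDl.
have [f0|fpos] : f (W0, t0) = 0 \/ 0 < f (W0, t0).
  have : 0 <= f (W0, t0) by rewrite /f -expr2 addr_ge0 ?rip_ge0 ?sqr_ge0.
  by rewrite le0r => /orP[/eqP|]; [left|right].
  (* The origin is attained: [W0] solves (D) up to normalization. The trace of
     [W0_00] cannot vanish, since then [W0 = 0], so [t0 = 1] and [r0 = -1]. *)
  have b00 : b0 = 0.
    apply: rip_eq0; have := rip_ge0 b0; have := sqr_ge0 r0.
    by move: f0; rewrite /f -/b0 -/r0 -expr2; lra.
  have r00 : r0 = 0.
    apply/eqP; rewrite -sqrf_eq0; move: f0.
    by rewrite /f -/b0 -/r0 b00 rip0l add0r -expr2 => ->.
  have tr2 := balance0_trace00 b00.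
  have /andP[tau_ge0 _] := trace00_bound pW0.
  have tau0 : 0 < trace00 W0.
    rewrite lt0r tau_ge0 andbT; apply/eqP => tau0.
    have W00 : W0 = 0 by apply: psd_tr0; rewrite // tr2 tau0 mulr0.
    move: r00 tr0; rewrite /r0 /r /= tau0 W00 rip0r mxtrace0 /=; lra.
  have [dG oG] := dual_feasible_of pW0 b00 tau0.
  exists (blocks_of ((trace00 W0)^-1%:C *: W0)); split=> //.
  rewrite oG ler_pdivlMr //; move: r00; rewrite /r0 /r /=; lra.
(* The origin is separated: [opt] reads [e <= <b0, .> + r0 * .] on the image.
   Evaluated at [(0, 1)] it gives [r0 <= - e < 0], so that dividing by [- r0]
   is possible and yields a feasible point of value less than [p]. *)
exfalso.
have r0lt : f (W0, t0) <= - r0.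
  have blk0 : blocks_of (0 : 'M[R[i]]_dim) = fun _ _ => 0.
    by do 2!apply/funext => ?; apply/matrixP => a b; rewrite !mxE.
  have := opt _ S01; have -> : bal (0, 1) = 0.
    by rewrite /bal blk0 /balance big1 // subrr.
  have -> : r (0, 1) = - 1.
    rewrite /r /trace00 blk0 mxtrace0 rip0r /=; ring.
  by rewrite rip0r mulrN1 add0r.
have hb0 : b0^t* = b0.
  have H i : (blocks_of W0 i i)^t* = blocks_of W0 i i.
    by have /psdmxP[] := psd_block i pW0.
  rewrite /b0 /bal /balance adjmxD adjmxN adjmx_sum H.
  by under eq_bigr do rewrite H.
set e := f (W0, t0) in fpos opt r0lt.
clearbody e b0 r0.
have k0 : 0 < - r0 by lra.
pose k := (- r0)^-1; have k_gt0 : 0 < k by rewrite invr_gt0.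
have kr : k * r0 = -1 by rewrite /k invrN mulNr mulVf // lt_eqF; lra.
suff F : primal_feasible A (p - k * e) ((- k)%:C *: b0).
  by have := plb _ _ F; have := mulr_gt0 k_gt0 fpos; lra.
apply/primal_feasibleP => //; split.
  by rewrite adjmxZ hb0.
move=> v; have [->|v0] := eqVneq v 0; first by rewrite mul0mx rip0r.
pose nv := rip (v *m v^t*) 1%:M; have nv0 : 0 < nv := sqnorm_gt0 v0.
have nvE : Re (\tr (v *m v^t*)) = nv by rewrite /nv ripC rip_tr mul1r.
pose V := nv^-1%:C *: (v *m v^t*).
have pV : psdmx V by apply: psdZ; [rewrite invr_ge0 ltW|exact: psd_rank1].
have trV : Re (\tr V) = 1.
  by rewrite mxtraceZ ReM /= mul0r subr0 nvE mulVf // gt_eqF.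
have -> : v *m v^t* = nv%:C *: V.
  by rewrite /V scalerA -rmorphM divff ?scale1r // gt_eqF.
rewrite ripZr pmulr_rge0 // rip_primal ripZl -/(trace00 V).
have := opt (V, 0); rewrite /r /= => /(_ _).
have /andP[_ ] := trace00_bound pV; rewrite trV => tau1.
have SV : S (V, 0) by split=> //=; rewrite trV; lra.
move=> /(_ SV) /(ler_wpM2l (ltW k_gt0)); rewrite mulrDr [k * (r0 * _)]mulrA kr.
have := mulr_ge0 (mulr_ge0 (ltW k_gt0) (ltW fpos)) (_ : 0 <= 1 - trace00 V).
rewrite subr_ge0 => /(_ tau1); rewrite /bal /= => ? ?; lra.
Qed.

End StrongDuality.

(** * The Lagrangian duals *)

Section Lagrangians.
Context {R : realType} {d n : nat}.
Variable A : 'I_n.+1 -> 'M[R[i]]_d.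
Implicit Types (Z : 'M[R[i]]_d) (G : blocks R d n).

Lemma primal_lagrangianE c Z G : primal_lagrangian A c Z G =
  dual_obj A G + c * (1 - Re (\tr (G ord0 ord0))) + rip Z (balance G).
Proof. by rewrite /primal_lagrangian -/(rip _ _) rip_primal_mx; ring. Qed.

Lemma dual_lagrangianE c Z G :
  dual_lagrangian A G c Z = c - rip (primal_mx A c Z) (assemble G).
Proof.
rewrite rip_primal_mx /dual_lagrangian -/(rip Z _) -/(balance G); ring.
Qed.

Lemma dual_feasibleP G : psd_blocks G -> dual_feasible G <->
  Re (\tr (G ord0 ord0)) = 1 /\ balance G = 0.
Proof.
move=> pG; split=> [[_ bal tr1]|[tr1 bal]].
  by rewrite tr1 /balance bal subrr.
split=> //; first by apply/eqP; rewrite -subr_eq0 -/(balance G) bal.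
by rewrite -herm_tr_real ?tr1 //; case: pG => hG _; exact: hG.
Qed.

(** A function that is affine and not constant along some line of its domain is
    unbounded below. *)
Lemma ereal_inf_line (T : Type) (D : set T) (f : T -> R) (g : R -> T) a b :
  b != 0 -> (forall t, D (g t) /\ f (g t) = a + t * b) ->
  ereal_inf [set (f x)%:E | x in D]%classic = -oo%E.
Proof.
move=> b0 H.
have low y : (ereal_inf [set (f x)%:E | x in D]%classic <= y%:E)%E.
  have [Dg fg] := H ((y - a) / b).
  apply: ereal_inf_lbound; exists (g ((y - a) / b)) => //.
  by rewrite fg divfK // addrC subrK.
case: (ereal_inf _) low => [r|/(_ 0)|//] //.
by move/(_ (r - 1)); rewrite lee_fin => ?; exfalso; lra.
Qed.

(** The Lagrangian of (P) is affine in [(c, Z)]. It is constant at a feasible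
    [G]; otherwise it has a nonzero slope along the multiples of [(1, 0)] when
    the trace is wrong, or of [(0, balance G)]. *)
Lemma dual_is_lagrangian_dual : dual_is_lagrangian_dual_of_primal A.
Proof.
move=> G pG; case: asboolP => [/(dual_feasibleP pG)[tr1 bal]|nfeas].
  apply/eqP; rewrite eq_le; apply/andP; split.
    apply: ereal_inf_lbound; exists (0, 0) => /=.
      by apply/hermP; rewrite linear0 map_mx0.
    by rewrite primal_lagrangianE bal rip0r tr1 subrr mulr0 !addr0.
  apply: le_ereal_inf_tmp => _ [[c Z] /= hZ <-].
  by rewrite primal_lagrangianE bal rip0r tr1 subrr mulr0 !addr0.
have [tr1|tr1] := eqVneq (Re (\tr (G ord0 ord0))) 1; last first.
  apply: (@ereal_inf_line _ _ _ (fun t => (t, 0)) (dual_obj A G)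
            (1 - Re (\tr (G ord0 ord0)))).
    by rewrite subr_eq0 eq_sym.
  move=> t; split; first by apply/hermP; rewrite linear0 map_mx0.
  by rewrite primal_lagrangianE rip0l addr0.
have bal : balance G != 0 by apply/eqP => bal; apply/nfeas/dual_feasibleP.
have hbal : (balance G)^t* = balance G.
  rewrite /balance adjmxD adjmxN adjmx_sum; have [hG _] := pG.
  by rewrite hG; under eq_bigr do rewrite hG.
apply: (@ereal_inf_line _ _ _ (fun t => (0, t%:C *: balance G)) (dual_obj A G)
          (rip (balance G) (balance G))).
  by apply: contra bal => /eqP/rip_eq0 ->.
move=> t; split; first by apply/hermP; rewrite adjmxZ hbal.
by rewrite primal_lagrangianE mul0r addr0 ripZl.
Qed.

(** Infeasibility of [(c, Z)] provides a rank one [G] with a negative pairing,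
    along whose ray the Lagrangian of (D) is unbounded above; for a feasible
    pair the supremum is attained at [G = 0]. *)
Lemma primal_is_lagrangian_dual : (forall i, (A i)^t* = A i) ->
  primal_is_lagrangian_dual_of_dual A.
Proof.
move=> hA c Z /hermP hZ; case: asboolP => [[_ pP]|nfeas].
  apply/eqP; rewrite eq_le; apply/andP; split.
    apply: ge_ereal_sup => _ [G /psd_blocksP pG <-].
    by rewrite dual_lagrangianE lee_fin gerBl rip_psd_ge0.
  apply: ereal_sup_ubound; exists (blocks_of 0).
    by apply: psd_blocks_of; exact: psd0.
  by rewrite dual_lagrangianE blocks_ofK rip0r subr0.
have [v neg] : exists v : 'cV_(\sum_(i < n.+1) d),
    rip (primal_mx A c Z) (v *m v^t*) < 0.
  apply/not_existsP => H; apply/nfeas/primal_feasibleP => //.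
  by split=> // v; rewrite leNgt; apply/negP; exact: H.
apply/eqyP => y y0.
set q := rip _ _ in neg.
pose t := (c - y) / q.
pose s := Num.max 0 t.
have s0 : 0 <= s by rewrite le_max lexx.
pose G := blocks_of (s%:C *: (v *m v^t*)).
apply: (@le_trans _ _ (dual_lagrangian A G c Z)%:E).
  rewrite dual_lagrangianE blocks_ofK ripZr -/q lee_fin.
  have : s * q <= t * q by rewrite ler_nM2r // le_max lexx orbT.
  by rewrite /t divfK ?lt_eqF // => ?; lra.
apply: ereal_sup_ubound; exists G => //.
by apply: psd_blocks_of; apply: psdZ => //; exact: psd_rank1.
Qed.

End Lagrangians.

Theorem theorem1p11 (R : realType) (d n : nat) (d_ge1 : (1 <= d)%N)
    (n_ge1 : (1 <= n)%N) (A : 'I_n.+1 -> 'M[R[i]]_d)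
    (A_herm : forall i, A i \is hermsymmx) :
  (primal_value A = (Lambda_sc A)%:E /\ dual_value A = (Lambda_sc A)%:E) /\
  (dual_is_lagrangian_dual_of_primal A /\
   primal_is_lagrangian_dual_of_dual A) /\
  ((exists c Z, primal_minimizer A c Z) /\ (exists G, dual_maximizer A G)).
Proof.
have hA i : (A i)^t* = A i by exact/hermP.
have Lle c Z : primal_feasible A c Z -> Lambda_sc A <= c.
  exact: Lambda_sc_le.
have [Z FZ] := primal_attained d_ge1 n_ge1 hA.
have [G [FG LG]] := strong_duality hA Lle.
have Gle G' : dual_feasible G' -> dual_obj A G' <= Lambda_sc A.
  exact: weak_duality FZ.
have objG : dual_obj A G = Lambda_sc A.
  by apply/eqP; rewrite eq_le Gle.
split; split.
- apply/eqP; rewrite eq_le; apply/andP; split.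
    by apply: ereal_inf_lbound; exists (Lambda_sc A) => //; exists Z.
  by apply: le_ereal_inf_tmp => _ [c [Z' F] <-]; rewrite lee_fin (Lle _ _ F).
- apply/eqP; rewrite eq_le; apply/andP; split.
    by apply: ge_ereal_sup => _ [G' F <-]; rewrite lee_fin Gle.
  by apply: ereal_sup_ubound; exists G; rewrite ?objG.
- by split; [exact: dual_is_lagrangian_dual|exact: primal_is_lagrangian_dual].
split.
- by exists (Lambda_sc A), Z.
- by exists G; split=> // G' F; rewrite objG Gle.
Qed.
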